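(* There does not exist any locally dually flat proper twisted product Finsler manifold.
   Context: Let $(M_1,F_1)$, $(M_2,F_2)$ be Finsler manifolds (metrics smooth on the slit tangent bundle, positively 1-homogeneous on fibres, with positive definite fundamental tensor) and $f:M_1\times M_2\to\mathbb{R}^+$ smooth. The twisted product $M_1\times_f M_2$ is $M=M_1\times M_2$ with $F=\sqrt{F_1^2(x,y)+f^2(x,u)F_2^2(u,v)}$, considered where $y\ne0$, $v\ne 0$. Local coordinates on $M$ are product coordinates $\mathbf{x}^a=(x^i,u^\alpha)$, with $(x^i)$ coordinates on $M_1$ and $(u^\alpha)$ on $M_2$, and fibre coordinates $\mathbf{y}^a=(y^i,v^\alpha)$. The twisted product is proper if $f$ genuinely depends on both factors, i.e. neither $\partial f/\partial x^i$ (all $i$) nor $\partial f/\partial u^\alpha$ (all $\alpha$) vanishes identically. $F$ is locally dually flat if around every point there is such a product coordinate system $(\mathbf x^a)=(x^i,u^\alpha)$ in which $$\frac{\partial^2F^2}{\partial\mathbf x^b\partial\mathbf y^a}\mathbf y^b=2\frac{\partial F^2}{\partial\mathbf x^a}.$$ *)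

(* Defs.v *)
From HB Require Import structures.
From mathcomp Require Import all_boot all_order all_algebra.
From mathcomp Require Import all_classical all_reals all_analysis.

Set Implicit Arguments.
Unset Strict Implicit.
Unset Printing Implicit Defensive.

Import Order.TTheory GRing.Theory Num.Theory.
Import numFieldNormedType.Exports.

Local Open Scope classical_set_scope.
Local Open Scope ring_scope.

(* C^oo on an open set U of a finite-dimensional space: all iterated
   directional derivatives exist and are continuous on U. *)
Definition iter_derive (R : realType) (V W : normedModType R)
    (f : V -> W) (vs : seq V) : V -> W :=
  foldl (fun g v => 'D_v g) f vs.

Definition smooth_on (R : realType) (V W : normedModType R)
    (U : set V) (f : V -> W) : Prop :=
  forall (vs : seq V) (x : V), U x ->
    {for x, continuous (iter_derive f vs)} /\
    forall v : V, derivable (iter_derive f vs) x v.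

(* Homeomorphism from an open subset of M onto an open subset of R^n;
   the values of the two maps outside these open sets are irrelevant. *)
Record chart (R : realType) (M : topologicalType) (n : nat) := Chart {
  chart_dom : set M;
  chart_map : M -> 'rV[R]_n;
  chart_inv : 'rV[R]_n -> M;
  chart_dom_open : open chart_dom;
  chart_img_open : open (chart_map @` chart_dom);
  chart_map_continuous : {in chart_dom, continuous chart_map};
  chart_inv_continuous : {in chart_map @` chart_dom, continuous chart_inv};
  chart_mapK : {in chart_dom, cancel chart_map chart_inv}
}.

Definition chart_img (R : realType) (M : topologicalType) (n : nat)
    (c : chart R M n) : set 'rV[R]_n :=
  chart_map c @` chart_dom c.

Definition transition (R : realType) (M : topologicalType) (n : nat)
    (c d : chart R M n) : 'rV[R]_n -> 'rV[R]_n :=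
  chart_map d \o chart_inv c.

Definition chart_compatible (R : realType) (M : topologicalType) (n : nat)
    (c d : chart R M n) : Prop :=
  smooth_on (chart_map c @` (chart_dom c `&` chart_dom d)) (transition c d) /\
  smooth_on (chart_map d @` (chart_dom c `&` chart_dom d)) (transition d c).

(* The atlas is the maximal one, so that its elements are exactly the local
   coordinate systems of the manifold. *)
Record manifold (R : realType) (n : nat) := Manifold {
  mcarrier :> topologicalType;
  atlas : set (chart R mcarrier n);
  manifold_hausdorff : hausdorff_space mcarrier;
  manifold_second_countable : @second_countable mcarrier;
  atlas_cover : forall p : mcarrier, exists2 c, atlas c & chart_dom c p;
  atlas_compatible : forall c d, atlas c -> atlas d -> chart_compatible c d;
  atlas_maximal : forall c,
    (forall d, atlas d -> chart_compatible c d) -> atlas c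
}.

Definition fundamental_tensor (R : realType) (n : nat)
    (L : 'rV[R]_n -> R) (y : 'rV[R]_n) : 'M[R]_n :=
  \matrix_(i, j) (2^-1 *
    'D_(delta_mx 0 j) ('D_(delta_mx 0 i) (fun y' => L y' ^+ 2)) y).

(* A tangent vector at p is given by a chart c around p and components y,
   standing for y^i d/dx^i|_p, where (c, y) and (d, z) give the same vector
   iff z is the image of y under the differential of the transition map.  A
   function on TM is thus a function F of triples (c, p, y) invariant under
   this identification. *)
Record finsler_metric (R : realType) (n : nat) (M : manifold R n) := Finsler {
  fmetric :> chart R M n -> M -> 'rV[R]_n -> R;
  fmetric_tangent : forall c d (p : M) (y : 'rV[R]_n),
    atlas c -> atlas d -> chart_dom c p -> chart_dom d p ->
    fmetric d p ('D_y (transition c d) (chart_map c p)) = fmetric c p y;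
  fmetric_ge0 : forall c (p : M) (y : 'rV[R]_n),
    atlas c -> chart_dom c p -> 0 <= fmetric c p y;
  fmetric_smooth : forall c, atlas c ->
    smooth_on [set z : 'rV[R]_n * 'rV[R]_n | chart_img c z.1 /\ z.2 != 0]
      (fun z => fmetric c (chart_inv c z.1) z.2);
  fmetric_homogeneous : forall c (p : M) (y : 'rV[R]_n) (l : R),
    atlas c -> chart_dom c p -> 0 < l ->
    fmetric c p (l *: y) = l * fmetric c p y;
  fmetric_posdef : forall c (p : M) (y w : 'rV[R]_n),
    atlas c -> chart_dom c p -> y != 0 -> w != 0 ->
    0 < (w *m fundamental_tensor (fmetric c p) y *m w^T) 0 0
}.

Section ProductCoordinates.
Variables (R : realType) (n1 n2 : nat).

(* Index a of the product coordinates: inl i for x^i, inr alpha for u^alpha. *)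
Definition pbasis (a : 'I_n1 + 'I_n2) : 'rV[R]_n1 * 'rV[R]_n2 :=
  match a with
  | inl i => (delta_mx 0 i, 0)
  | inr k => (0, delta_mx 0 k)
  end.

Definition pcoord (y : 'rV[R]_n1 * 'rV[R]_n2) (a : 'I_n1 + 'I_n2) : R :=
  match a with
  | inl i => y.1 0 i
  | inr k => y.2 0 k
  end.

End ProductCoordinates.

Definition in_coords (R : realType) (n1 n2 : nat)
    (M1 : manifold R n1) (M2 : manifold R n2) (f : M1 * M2 -> R)
    (c1 : chart R M1 n1) (c2 : chart R M2 n2)
    (x : 'rV[R]_n1 * 'rV[R]_n2) : R :=
  f (chart_inv c1 x.1, chart_inv c2 x.2).

Record twisting_function (R : realType) (n1 n2 : nat)
    (M1 : manifold R n1) (M2 : manifold R n2) := Twisting {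
  twist_fun :> M1 * M2 -> R;
  twist_gt0 : forall p, 0 < twist_fun p;
  twist_smooth : forall c1 c2, atlas c1 -> atlas c2 ->
    smooth_on (chart_img c1 `*` chart_img c2) (in_coords twist_fun c1 c2)
}.

Definition twisted_metric (R : realType) (n1 n2 : nat)
    (M1 : manifold R n1) (M2 : manifold R n2)
    (F1 : finsler_metric M1) (F2 : finsler_metric M2)
    (f : twisting_function M1 M2)
    (c1 : chart R M1 n1) (c2 : chart R M2 n2)
    (x y : 'rV[R]_n1 * 'rV[R]_n2) : R :=
  Num.sqrt (F1 c1 (chart_inv c1 x.1) y.1 ^+ 2 +
            in_coords f c1 c2 x ^+ 2 * F2 c2 (chart_inv c2 x.2) y.2 ^+ 2).

Definition dx_vanishes (R : realType) (n1 n2 : nat)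
    (M1 : manifold R n1) (M2 : manifold R n2) (f : M1 * M2 -> R) : Prop :=
  forall c1 c2 x, atlas c1 -> atlas c2 -> chart_img c1 x.1 ->
    chart_img c2 x.2 ->
    forall i : 'I_n1, 'D_(pbasis R (inl i)) (in_coords f c1 c2) x = 0.

Definition du_vanishes (R : realType) (n1 n2 : nat)
    (M1 : manifold R n1) (M2 : manifold R n2) (f : M1 * M2 -> R) : Prop :=
  forall c1 c2 x, atlas c1 -> atlas c2 -> chart_img c1 x.1 ->
    chart_img c2 x.2 ->
    forall k : 'I_n2, 'D_(pbasis R (inr k)) (in_coords f c1 c2) x = 0.

Definition proper_twisted (R : realType) (n1 n2 : nat)
    (M1 : manifold R n1) (M2 : manifold R n2)
    (f : twisting_function M1 M2) : Prop :=
  ~ dx_vanishes f /\ ~ du_vanishes f.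

Definition locally_dually_flat (R : realType) (n1 n2 : nat)
    (M1 : manifold R n1) (M2 : manifold R n2)
    (F1 : finsler_metric M1) (F2 : finsler_metric M2)
    (f : twisting_function M1 M2) : Prop :=
  forall (p1 : M1) (p2 : M2), exists (c1 : chart R M1 n1) (c2 : chart R M2 n2),
    [/\ atlas c1, atlas c2, chart_dom c1 p1, chart_dom c2 p2 &
    forall x y : 'rV[R]_n1 * 'rV[R]_n2,
      chart_img c1 x.1 -> chart_img c2 x.2 -> y.1 != 0 -> y.2 != 0 ->
      let Fsq x' y' := twisted_metric F1 F2 f c1 c2 x' y' ^+ 2 in
      forall a : 'I_n1 + 'I_n2,
        \sum_(b : 'I_n1 + 'I_n2)
           'D_(pbasis R b) (fun x' => 'D_(pbasis R a) (Fsq x') y) x * pcoord y b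
        = 2 * 'D_(pbasis R a) (fun x' => Fsq x' y) x].

(* Main.v *)
Require Import Defs.
From mathcomp Require Import all_boot all_order all_algebra.
From mathcomp Require Import all_classical all_reals all_analysis.
From mathcomp Require Import lra.

(** Only the equations with index [a = k] in the first factor are needed.  There
    the left-hand side does not see [F2], whereas the right-hand side is
    [2 (d_k F1^2 + F2^2 d_k (f^2))].  Replacing [v] by [2 v] multiplies [F2^2]
    by 4 and changes nothing else, so [d_k (f^2) = 0] in the dually flat
    coordinates.  Hence [f] is locally constant along [M1], which no longer
    refers to coordinates, so [df/dx^i] vanishes in every chart and the twisted
    product is not proper. *)

Set Implicit Arguments.
Unset Strict Implicit.
Unset Printing Implicit Defensive.

Import Order.TTheory GRing.Theory Num.Theory.
Import numFieldNormedType.Exports.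

Local Open Scope classical_set_scope.
Local Open Scope ring_scope.

Section DirectionalDerivatives.
Variable R : realType.

(** Derivability and derivative depend only on increments along the direction, so both pass between
    functions on different spaces, such as a function on a product and its restriction to a factor
    or a line. *)
Lemma eq_diff_quotient (U V W : normedModType R) (f : U -> W) (g : V -> W)
    (a v : U) (b w : V) :
  (forall h : R, f (h *: v + a) - f a = g (h *: w + b) - g b) ->
  (derivable f a v <-> derivable g b w) /\ 'D_v f a = 'D_w g b.
Proof.
move=> fg; rewrite /derivable /derive.
suff -> : (fun h : R => h^-1 *: ((f \o shift a) (h *: v) - f a)) =
          (fun h : R => h^-1 *: ((g \o shift b) (h *: w) - g b)) by [].
by apply/funext => h; rewrite /= fg.
Qed.

Lemma derive_near_cst (V W : normedModType R) (f : V -> W) (a v : V) :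
  (\forall h \near (0 : R), f (h *: v + a) = f a) -> 'D_v f a = 0.
Proof.
move=> fa; rewrite /derive; apply: lim_near_cst => //.
apply: nbhs_dnbhs; apply: filterS fa => h /= ->.
by rewrite subrr scaler0.
Qed.

Lemma derive_line_cst (V W : normedModType R) (f : V -> W) (a v : V) :
  (forall h : R, f (h *: v + a) = f a) -> 'D_v f a = 0.
Proof. by move=> fa; apply: derive_near_cst; apply: filterE. Qed.

Lemma derive_sqr_addM_sqr (V : normedModType R) (A g : V -> R) (b : R)
    (a v : V) :
  derivable A a v -> derivable g a v ->
  'D_v (fun z => A z ^+ 2 + b * g z ^+ 2) a =
  'D_v (fun z => A z ^+ 2) a + b * (2 * g a * 'D_v g a).
Proof.
move=> dA dg; have dg2 : derivable (g ^+ 2) a v := derivableX dg.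
have dA2 : derivable (A ^+ 2) a v := derivableX dA.
have dbg2 : derivable (b \*: (g ^+ 2)) a v by exact: derivableZ.
have -> : (fun z => A z ^+ 2 + b * g z ^+ 2) = A ^+ 2 + b \*: (g ^+ 2) by [].
have -> : (fun z => A z ^+ 2) = A ^+ 2 by [].
rewrite (deriveD dA2 dbg2) (deriveZ b dg2) (deriveX 2 dg).
by rewrite /GRing.scale /= expr1.
Qed.

(** Mean value theorem for [g t = phi (t *: v + z)]; the symmetric bound on [t] covers both signs of
    [s]. *)
Lemma line_derive0_cst (V : normedModType R) (phi : V -> R) (z v : V) (s : R) :
  (forall t, `|t| <= `|s| -> is_derive (t *: v + z) v phi 0) ->
  phi (s *: v + z) = phi z.
Proof.
move=> dphi; pose g (t : R) := phi (t *: v + z).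
have dg (t : R) : `|t| <= `|s| -> is_derive t (1 : R) g 0.
  move=> /dphi [dvb dv0].
  have quot (h : R) : g (h *: 1 + t) - g t =
      phi (h *: v + (t *: v + z)) - phi (t *: v + z).
    by rewrite /g /GRing.scale /= mulr1 addrA -scalerDl.
  have [dE DE] := eq_diff_quotient quot.
  by split; [apply/dE | rewrite DE].
have mvt (a b : R) : a <= b -> `|a| <= `|s| -> `|b| <= `|s| -> g b = g a.
  rewrite !ler_norml => ab /andP[a1 a2] /andP[b1 b2].
  have ts (t : R) : t \in `[a, b] -> `|t| <= `|s|.
    by rewrite in_itv/= ler_norml => /andP[at_ tb]; apply/andP; split; lra.
  have [t||c _ /eqP] := @MVT_segment R g (fun=> 0) a b ab.
  - by move=> /subset_itv_oo_cc /ts /dg.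
  - by apply: derivable_within_continuous => t /ts /dg [].
  - by rewrite mul0r subr_eq0 => /eqP.
have g0 : phi z = g 0 by rewrite /g scale0r add0r.
rewrite g0 -/(g s); have [s0|s0] := leP 0 s.
- by apply: mvt; rewrite ?normr0.
- by apply/esym/mvt; rewrite ?normr0 // ltW.
Qed.

(* The sup-norm ball is a box, so any point of it is joined to the centre by
   changing one coordinate at a time without leaving it. *)
Lemma partials0_cst_on_ball (n : nat) (phi : 'rV[R]_n -> R) (x : 'rV[R]_n)
    (r : R) :
  (forall z, ball x r z -> forall i, is_derive z (delta_mx 0 i) phi 0) ->
  forall z, ball x r z -> phi z = phi x.
Proof.
move=> dphi z [r0 xz].
pose w k : 'rV[R]_n := \row_j (if (j < k)%N then z 0 j else x 0 j).
have wx k : (k <= n)%N -> phi (w k) = phi x.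
  elim: k => [_|k IH kn].
    by congr phi; apply/rowP => j; rewrite mxE ltn0.
  rewrite -IH ?(ltnW kn) //; pose i := Ordinal kn.
  have -> : w k.+1 = (z 0 i - x 0 i) *: delta_mx 0 i + w k.
    apply/rowP => j; rewrite !mxE eqxx/= ltnS.
    have [->|ji] := eqVneq j i; first by rewrite /= leqnn ltnn; lra.
    have jk : (j : nat) != k by [].
    by rewrite leq_eqVlt (negbTE jk) mulr0 add0r.
  (* Coordinate [i] stays within [|z 0 i - x 0 i| < r] of [x 0 i]; every other coordinate is that of
     [z] or of [x]. *)
  apply: line_derive0_cst => t ts; apply: dphi; split=> // a j.
  rewrite !ord1 !mxE eqxx/=; have := xz 0 j.
  have [->|ji] := eqVneq j i.
    rewrite /= ltnn mulr1 /ball/= opprD addrCA subrr addr0 normrN distrC.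
    exact: le_lt_trans.
  by rewrite mulr0 add0r; case: ifP => // _ _; apply: ballxx.
rewrite -(wx n) //; congr phi.
by apply/rowP => j; rewrite mxE ltn_ord.
Qed.

End DirectionalDerivatives.

Section TwistedProduct.
Variables (R : realType) (n1 n2 : nat) (M1 : manifold R n1) (M2 : manifold R n2).
Variables (F1 : finsler_metric M1) (F2 : finsler_metric M2).
Variable f : twisting_function M1 M2.

Lemma delta_mx_neq0 n (i : 'I_n) : (delta_mx 0 i : 'rV[R]_n) != 0.
Proof.
apply/eqP => /rowP /(_ i) /eqP.
by rewrite !mxE !eqxx oner_eq0.
Qed.

(** If [F c p] vanished identically, so would its fundamental tensor, against positive definiteness.
    The index [i] provides a nonzero vector on which to test this. *)
Lemma fmetric_neq0 n (M : manifold R n) (F : finsler_metric M) c (p : M)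
    (i : 'I_n) :
  atlas c -> chart_dom c p -> exists2 v : 'rV[R]_n, v != 0 & F c p v != 0.
Proof.
move=> ac cp; apply: contrapT => noF.
have F0 v : F c p v = 0.
  have [->|v0] := eqVneq v 0; last first.
    by apply/eqP; apply: contrapT => /negP Fv; apply: noF; exists v.
  (* At the zero vector, homogeneity with factor 2 gives [F c p 0 = 2 * F c p 0]. *)
  have := @fmetric_homogeneous _ _ _ F c p 0 2 ac cp (ltr0n _ 2).
  by rewrite scaler0; lra.
have d0 := delta_mx_neq0 i.
have := @fmetric_posdef _ _ _ F c p _ _ ac cp d0 d0.
suff -> : fundamental_tensor (F c p) (delta_mx 0 i) = 0.
  by rewrite mulmx0 mul0mx mxE ltxx.
apply/matrixP => j k; rewrite !mxE.
have -> : (fun y' => F c p y' ^+ 2) = cst 0.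
  by apply/funext => y; rewrite F0 expr0n.
have -> : 'D_(delta_mx 0 j) (cst 0 : 'rV[R]_n -> R) = cst 0.
  by apply/funext => y; rewrite derive_cst.
by rewrite derive_cst mulr0.
Qed.

Lemma twisted_metric_sqr c1 c2 x y :
  twisted_metric F1 F2 f c1 c2 x y ^+ 2 =
  F1 c1 (chart_inv c1 x.1) y.1 ^+ 2 +
  in_coords f c1 c2 x ^+ 2 * F2 c2 (chart_inv c2 x.2) y.2 ^+ 2.
Proof. by rewrite sqr_sqrtr //; apply: addr_ge0; rewrite -?exprMn sqr_ge0. Qed.

(** The [F2] term is constant in [y^i] and cancels in the increments. The identity holds at every
    [x], so it can be rewritten under the outer derivative in [x]. *)
Lemma derive_twisted_sqr_y c1 c2 x y i :
  'D_(pbasis R (inl i)) (fun y' => twisted_metric F1 F2 f c1 c2 x y' ^+ 2) y =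
  'D_(delta_mx 0 i) (fun z => F1 c1 (chart_inv c1 x.1) z ^+ 2) y.1.
Proof.
apply: (eq_diff_quotient _).2 => h.
rewrite !twisted_metric_sqr /= scaler0 add0r; lra.
Qed.

Lemma derive_twisted_sqr_x c1 c2 x y i :
  atlas c1 -> atlas c2 -> chart_img c1 x.1 -> chart_img c2 x.2 -> y.1 != 0 ->
  'D_(pbasis R (inl i)) (fun x' => twisted_metric F1 F2 f c1 c2 x' y ^+ 2) x =
  'D_(delta_mx 0 i) (fun z => F1 c1 (chart_inv c1 z) y.1 ^+ 2) x.1 +
  F2 c2 (chart_inv c2 x.2) y.2 ^+ 2 *
    (2 * in_coords f c1 c2 x * 'D_(pbasis R (inl i)) (in_coords f c1 c2) x).
Proof.
move=> a1 a2 x1 x2 y1.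
set e := pbasis R (inl i); set b := F2 _ _ _ ^+ 2.
pose G (x' : 'rV[R]_n1 * 'rV[R]_n2) := F1 c1 (chart_inv c1 x'.1) y.1.
have df : derivable (in_coords f c1 c2) x e.
  by have [_] := twist_smooth f a1 a2 [::] (conj x1 x2); apply.
(* [F1] is smooth off the zero section; keeping the fibre component [y.1] fixed amounts to the
   direction [(delta_mx 0 i, 0)]. *)
have dG : derivable G x e.
  have [_ /(_ (delta_mx 0 i, 0))] :=
    @fmetric_smooth _ _ _ F1 c1 a1 [::] (x.1, y.1) (conj x1 y1).
  apply: (eq_diff_quotient _).1.2 => h.
  by rewrite /G /= scaler0 add0r.
transitivity ('D_e (fun x' => G x' ^+ 2 + b * in_coords f c1 c2 x' ^+ 2) x).
  apply: (eq_diff_quotient _).2 => h; rewrite !twisted_metric_sqr.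
  by rewrite /G /= scaler0 add0r -/b ![b * _]mulrC.
by rewrite (derive_sqr_addM_sqr b dG df); congr (_ + _).
Qed.

Lemma dually_flat_derive0 c1 c2 x (i : 'I_n1) (k : 'I_n2) :
  atlas c1 -> atlas c2 -> chart_img c1 x.1 -> chart_img c2 x.2 ->
  (forall y : 'rV[R]_n1 * 'rV[R]_n2, y.1 != 0 -> y.2 != 0 ->
    \sum_(b : 'I_n1 + 'I_n2)
      'D_(pbasis R b) (fun x' => 'D_(pbasis R (inl i))
         (fun y' => twisted_metric F1 F2 f c1 c2 x' y' ^+ 2) y) x * pcoord y b
    = 2 * 'D_(pbasis R (inl i))
            (fun x' => twisted_metric F1 F2 f c1 c2 x' y ^+ 2) x) ->
  is_derive x (pbasis R (inl i)) (in_coords f c1 c2) 0.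
Proof.
move=> a1 a2 x1 x2 flat.
have df : derivable (in_coords f c1 c2) x (pbasis R (inl i)).
  by have [_] := twist_smooth f a1 a2 [::] (conj x1 x2); apply.
split=> //; pose p := chart_inv c2 x.2.
have cp : chart_dom c2 p.
  by have [q q2 qx] := x2; rewrite /p -qx chart_mapK ?inE.
have [v v0 Fv] := fmetric_neq0 F2 k a2 cp.
have v20 : 2 *: v != 0 by rewrite scaler_eq0 negb_or v0 pnatr_eq0.
have d0 := delta_mx_neq0 i.
(* [D1] depends neither on the second fibre component nor on [x'.2]: the terms of index [inr j] drop
   out and the left-hand side [S] is the same for all [w]. *)
pose D1 (x' : 'rV[R]_n1 * 'rV[R]_n2) :=
  'D_(delta_mx 0 i) (fun z => F1 c1 (chart_inv c1 x'.1) z ^+ 2) (delta_mx 0 i).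
have D1E w : (fun x' => 'D_(pbasis R (inl i))
    (fun y' => twisted_metric F1 F2 f c1 c2 x' y' ^+ 2) (delta_mx 0 i, w)) = D1.
  by apply/funext => x'; rewrite derive_twisted_sqr_y.
pose S := \sum_j 'D_(pbasis R (inl j)) D1 x * (delta_mx 0 i : 'rV[R]_n1) 0 j.
have flatS w : w != 0 -> S = 2 * 'D_(pbasis R (inl i))
    (fun x' => twisted_metric F1 F2 f c1 c2 x' (delta_mx 0 i, w) ^+ 2) x.
  move=> w0; rewrite -(flat (delta_mx 0 i, w) d0 w0) D1E big_sumType /=.
  rewrite [X in _ + X]big1 ?addr0 // => j _.
  have -> : 'D_(pbasis R (inr j)) D1 x = 0; last exact: mul0r.
  by apply: derive_line_cst => h; rewrite /D1 /= scaler0 add0r.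
have E1 := flatS _ v0; have E2 := flatS _ v20.
rewrite derive_twisted_sqr_x // in E1; rewrite derive_twisted_sqr_x // in E2.
rewrite /= -/p fmetric_homogeneous ?ltr0n // exprMn in E2.
rewrite /= -/p in E1.
have f0 : in_coords f c1 c2 x != 0 by rewrite gt_eqF // twist_gt0.
(* [E1] and [E2] share [S] and the [F1] term, while the [F2] term of [E2] is four times that of
   [E1]; subtracting leaves a nonzero multiple of this product. *)
have /eqP : F2 c2 p v ^+ 2 * (in_coords f c1 c2 x *
   'D_(pbasis R (inl i)) (in_coords f c1 c2) x) = 0.
  by lra.
by rewrite mulf_eq0 sqrf_eq0 (negbTE Fv) mulf_eq0 (negbTE f0) => /eqP.
Qed.

(** Local constancy is what survives a change of chart: the flat coordinates come with the point,
    whereas [dx_vanishes] quantifies over the whole atlas. Stating it on the manifold avoids a chain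
    rule for transition maps. *)
Lemma dually_flat_locally_cst (k : 'I_n2) (p1 : M1) (p2 : M2) :
  locally_dually_flat F1 F2 f ->
  \forall q \near p1, f (q, p2) = f (p1, p2).
Proof.
move=> /(_ p1 p2) [c1 [c2 [a1 a2 cp1 cp2 flat]]].
have img2 : chart_img c2 (chart_map c2 p2) by exists p2.
have img1 : chart_img c1 (chart_map c1 p1) by exists p1.
have /nbhs_ballP[r /= r0 rimg] : nbhs (chart_map c1 p1) (chart_img c1).
  by apply: open_nbhs_nbhs; split=> //; exact: chart_img_open.
pose phi z := in_coords f c1 c2 (z, chart_map c2 p2).
have phi_cst z : ball (chart_map c1 p1) r z -> phi z = phi (chart_map c1 p1).
  apply: partials0_cst_on_ball => {}z /rimg z1 i.
  have [|dv d0] := @dually_flat_derive0 c1 c2 (z, chart_map c2 p2) i k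
    a1 a2 z1 img2.
    by move=> y y1 y2; apply: (flat (z, chart_map c2 p2) y).
  have [dE DE] := @eq_diff_quotient _ _ _ _ phi (in_coords f c1 c2) z
    (delta_mx 0 i) (z, chart_map c2 p2) (pbasis R (inl i))
    ltac:(by move=> h; rewrite /phi /in_coords /= scaler0 add0r).
  by split; [apply/dE | rewrite DE].
have near_dom : \forall q \near p1, chart_dom c1 q.
  by apply: open_nbhs_nbhs; split=> //; exact: chart_dom_open.
have near_ball : \forall q \near p1, ball (chart_map c1 p1) r (chart_map c1 q).
  by apply: (chart_map_continuous (mem_set cp1)); apply: nbhsx_ballx.
near=> q.
have cq : chart_dom c1 q by near: q.
have : phi (chart_map c1 q) = phi (chart_map c1 p1) by apply: phi_cst; near: q.
by rewrite /phi /in_coords /= !chart_mapK ?inE.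
Unshelve. all: by end_near. Qed.

Lemma dually_flat_dx_vanishes (k : 'I_n2) :
  locally_dually_flat F1 F2 f -> dx_vanishes f.
Proof.
move=> flat d1 d2 x a1 a2 x1 x2 i.
have cst1 := @dually_flat_locally_cst k (chart_inv d1 x.1) (chart_inv d2 x.2) flat.
(* The neighbourhood of constancy is pulled back through [chart_inv d1] to the coordinate line
   through [x.1]. *)
have line : (h *: delta_mx 0 i + x.1) @[h --> (0 : R)] -->
    (0 : R) *: (delta_mx 0 i : 'rV[R]_n1) + x.1.
  by apply: cvgD; [apply: cvgZr_tmp; exact: cvg_id | exact: cvg_cst].
rewrite scale0r add0r in line.
have near_cst := cvg_comp _ _ line (chart_inv_continuous (mem_set x1)) _ cst1.
apply: derive_near_cst.
apply: (@filterS _ (nbhs (0 : R)) _ _ _ _ near_cst) => h /=.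
by rewrite /in_coords /= scaler0 add0r.
Qed.

End TwistedProduct.

Theorem corollary6 (R : realType) :
  ~ exists (n1 n2 : nat) (M1 : manifold R n1) (M2 : manifold R n2)
      (F1 : finsler_metric M1) (F2 : finsler_metric M2)
      (f : twisting_function M1 M2),
      proper_twisted f /\ locally_dually_flat F1 F2 f.
Proof.
move=> [n1 [n2 [M1 [M2 [F1 [F2 [f [[ndx ndu] flat]]]]]]]].
(* For [n2 = 0], [du_vanishes] would hold vacuously; attacking it first yields the index [k], hence
   nonzero tangent vectors on [M2]. *)
apply: ndu => c1 c2 x _ _ _ _ k.
by case: ndx; apply: dually_flat_dx_vanishes k flat.
Qed.
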